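(* For every rational number $n$, define $$\begin{aligned} x_1&=16n^4-64n^3-13n^2-4n+1,\\ x_2&=32n^5-16n^4+30n^3+13n^2-2n-1,\\ x_3&=-32n^5+16n^4+26n^3-15n^2-2n-1,\\ x_4&=-32n^5-32n^4+26n^3-32n^2-2n,\\ y_1&=-32n^5+32n^4+26n^3+32n^2-2n,\\ y_2&=-32n^5-16n^4+26n^3+15n^2-2n+1,\\ y_3&=16n^4+64n^3-13n^2+4n+1,\\ y_4&=32n^5+16n^4+30n^3-13n^2-2n+1, \end{aligned}$$ and $x_5=-x_4$, $x_6=-x_3$, $x_7=-x_2$, $x_8=-x_1$, $y_5=-y_4$, $y_6=-y_3$, $y_7=-y_2$, $y_8=-y_1$. Then $$\sum_{i=1}^8x_i^r=\sum_{i=1}^8y_i^r\qquad\text{for } r=1,2,3,4,5,6,7.$$ Moreover, as a parametric solution this is nontrivial: in $\mathbb{Q}[n]$ the multisets $\{x_1,\dots,x_8\}$ and $\{y_1,\dots,y_8\}$ are distinct.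
   Context: An ideal solution of the Tarry-Escott problem of degree $k$ consists of two distinct multisets $\{x_1,\dots,x_{k+1}\}$, $\{y_1,\dots,y_{k+1}\}$ with $\sum x_i^r=\sum y_i^r$ for $r=1,\dots,k$. *)

(* Defs.v *)
From mathcomp Require Import all_boot all_order all_algebra.

Set Implicit Arguments.
Unset Strict Implicit.
Unset Printing Implicit Defensive.

Import GRing.Theory.
Local Open Scope ring_scope.

(* The formulas are written over an arbitrary commutative ring: at [n : rat]
   they give the rational numbers of the solution, and at ['X : {poly rat}]
   they give the solution as a family of elements of Q[n]. *)

Definition x1 (R : comNzRingType) (n : R) : R :=
  16 * n ^+ 4 - 64 * n ^+ 3 - 13 * n ^+ 2 - 4 * n + 1.
Definition x2 (R : comNzRingType) (n : R) : R :=
  32 * n ^+ 5 - 16 * n ^+ 4 + 30 * n ^+ 3 + 13 * n ^+ 2 - 2 * n - 1.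
Definition x3 (R : comNzRingType) (n : R) : R :=
  - 32 * n ^+ 5 + 16 * n ^+ 4 + 26 * n ^+ 3 - 15 * n ^+ 2 - 2 * n - 1.
Definition x4 (R : comNzRingType) (n : R) : R :=
  - 32 * n ^+ 5 - 32 * n ^+ 4 + 26 * n ^+ 3 - 32 * n ^+ 2 - 2 * n.

Definition y1 (R : comNzRingType) (n : R) : R :=
  - 32 * n ^+ 5 + 32 * n ^+ 4 + 26 * n ^+ 3 + 32 * n ^+ 2 - 2 * n.
Definition y2 (R : comNzRingType) (n : R) : R :=
  - 32 * n ^+ 5 - 16 * n ^+ 4 + 26 * n ^+ 3 + 15 * n ^+ 2 - 2 * n + 1.
Definition y3 (R : comNzRingType) (n : R) : R :=
  16 * n ^+ 4 + 64 * n ^+ 3 - 13 * n ^+ 2 + 4 * n + 1.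
Definition y4 (R : comNzRingType) (n : R) : R :=
  32 * n ^+ 5 + 16 * n ^+ 4 + 30 * n ^+ 3 - 13 * n ^+ 2 - 2 * n + 1.

(* Multisets are lists up to [perm_eq]. *)
Definition xs (R : comNzRingType) (n : R) : 8.-tuple R :=
  [tuple x1 n; x2 n; x3 n; x4 n; - x4 n; - x3 n; - x2 n; - x1 n].

Definition ys (R : comNzRingType) (n : R) : 8.-tuple R :=
  [tuple y1 n; y2 n; y3 n; y4 n; - y4 n; - y3 n; - y2 n; - y1 n].

(* Main.v *)
Require Import Defs.
From mathcomp Require Import all_boot all_order all_algebra.
From mathcomp Require Import ring.

Import GRing.Theory.
Local Open Scope ring_scope.

(** Both multisets are closed under negation, so odd power sums vanish and even ones are twice the
    sum over four representatives ([symmetric_power_sum]). Only the exponents 2, 4, 6 remain, and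
    these are polynomial identities in [n]. An equality of multisets over Q[n] would survive
    evaluation, so one rational point refutes it. *)

Lemma even_power_sums (R : comNzRingType) (n : R) (k : nat) :
  (1 <= k <= 3)%N ->
  x1 n ^+ k.*2 + x2 n ^+ k.*2 + x3 n ^+ k.*2 + x4 n ^+ k.*2 =
  y1 n ^+ k.*2 + y2 n ^+ k.*2 + y3 n ^+ k.*2 + y4 n ^+ k.*2.
Proof.
by case: k => [|[|[|[|k]]]] // _;
  rewrite /double /= /x1 /x2 /x3 /x4 /y1 /y2 /y3 /y4; ring.
Qed.

Lemma symmetric_power_sum (R : comNzRingType) (a b c d : R) (r : nat) :
  \sum_(i < 8) tnth [tuple a; b; c; d; - d; - c; - b; - a] i ^+ r =
  if odd r then 0 else (a ^+ r + b ^+ r + c ^+ r + d ^+ r) *+ 2.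
Proof.
rewrite !big_ord_recr big_ord0 /= !(tnth_nth 0) /= !(exprNn a, exprNn b, exprNn c, exprNn d).
(* Reducing the exponent of -1 to its parity leaves two cases, each linear in the powers of [a],
   [b], [c], [d]. *)
rewrite -signr_odd.
by case: (odd r); rewrite ?expr1 ?expr0; ring.
Qed.

(** Needed with [f] the evaluation of polynomials at a point and [n] the indeterminate. *)
Lemma map_xs (R S : comNzRingType) (f : {rmorphism R -> S}) (n : R) :
  map f (xs n) = xs (f n).
Proof.
have f1 : f (x1 n) = x1 (f n) by rewrite /x1; ring.
have f2 : f (x2 n) = x2 (f n) by rewrite /x2; ring.
have f3 : f (x3 n) = x3 (f n) by rewrite /x3; ring.
have f4 : f (x4 n) = x4 (f n) by rewrite /x4; ring.
by rewrite /= !(rmorphN f) f1 f2 f3 f4.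
Qed.

Lemma map_ys (R S : comNzRingType) (f : {rmorphism R -> S}) (n : R) :
  map f (ys n) = ys (f n).
Proof.
have f1 : f (y1 n) = y1 (f n) by rewrite /y1; ring.
have f2 : f (y2 n) = y2 (f n) by rewrite /y2; ring.
have f3 : f (y3 n) = y3 (f n) by rewrite /y3; ring.
have f4 : f (y4 n) = y4 (f n) by rewrite /y4; ring.
by rewrite /= !(rmorphN f) f1 f2 f3 f4.
Qed.

Theorem mainTheorem7 :
  (forall (n : rat) (r : nat), (1 <= r <= 7)%N ->
     \sum_(i < 8) tnth (xs n) i ^+ r = \sum_(i < 8) tnth (ys n) i ^+ r)
  /\ ~~ perm_eq (xs ('X : {poly rat})) (ys ('X : {poly rat})).
Proof.
split=> [n r /andP[r_gt0 r_le7]|].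
  rewrite !symmetric_power_sum; case: ifPn => // /even_halfK r_even.
  rewrite -r_even even_power_sums //.
  (* What remains is that half of [r] lies between 1 and 3; [r_even] excludes [r = 1]. *)
  by case: r r_gt0 r_le7 r_even => [|[|[|[|[|[|[|[|r]]]]]]]].
(* At n = 1 the specialised solution is trivial; n = 2 is not. *)
apply/negP=> /(perm_map (horner_eval (2 : rat))).
rewrite map_xs map_ys [X in xs X]hornerX [X in ys X]hornerX.
by apply/negP; vm_compute.
Qed.
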